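(* Let $\mathcal{H}$ be a nonempty finite class of hypotheses $h:X\to\{-1,+1\}$, let $D$ be a probability distribution on $X\times\{-1,+1\}$, and let $\epsilon=\min\{\varepsilon(h):h\in\mathcal{H}\}$. Let $\eta>0$ and $\Delta\ge0$ be such that $\Delta\eta\le1/2$. Then for any $\gamma\ge\ln(8|\mathcal{H}|)/\eta$, $$\Pr_{(x,y)\sim D}[y\,\ell_\eta(x)\le0]\le2\left(1+2|\mathcal{H}|e^{-\eta\gamma}\right)(\epsilon+\gamma),$$ and $$\Pr_{(x,y)\sim D}[y\,\ell_\eta(x)\le2\Delta]\le(1+e^{2\Delta\eta})\left(1+2|\mathcal{H}|e^{\eta(2\Delta-\gamma)}\right)(\epsilon+\gamma)\le4\left(1+2|\mathcal{H}|e^{\eta(2\Delta-\gamma)}\right)(\epsilon+\gamma).$$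
   Context: $X$ is a measurable space and all hypotheses are measurable. For $h\in\mathcal{H}$, the true error is $\varepsilon(h)=\Pr_{(x,y)\sim D}[h(x)\ne y]$. For $\eta>0$ and $x\in X$, the true log ratio is $$\ell_\eta(x)=\frac1\eta\ln\frac{\sum_{h\in\mathcal{H}:h(x)=+1}e^{-\eta\varepsilon(h)}}{\sum_{h\in\mathcal{H}:h(x)=-1}e^{-\eta\varepsilon(h)}},$$ with the convention $\ell_\eta(x)=+\infty$ if all hypotheses predict $+1$ on $x$, and $\ell_\eta(x)=-\infty$ if all hypotheses predict $-1$ on $x$. *)

(* Defs.v *)
From mathcomp Require Export all_boot all_order all_algebra finmap.
From mathcomp Require Export all_classical all_reals all_analysis.

Set Implicit Arguments.
Unset Strict Implicit.
Unset Printing Implicit Defensive.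

Export Order.TTheory GRing.Theory Num.Theory.
Export numFieldNormedType.Exports.

#[global] Open Scope ring_scope.
#[global] Open Scope classical_set_scope.

(* The two-point label space {-1, +1} is encoded by bool with its discrete
   sigma-algebra: true stands for +1 and false for -1; label_val is the
   corresponding real number. *)
Definition label_val (R : realType) (y : bool) : R := if y then 1 else -1.

Definition true_error (R : realType) (d : measure_display)
    (X : measurableType d) (D : probability (X * bool)%type R)
    (h : X -> bool) : R :=
  fine (D [set xy | h xy.1 != xy.2]).

Definition true_log_ratio (R : realType) (d : measure_display)
    (X : measurableType d) (D : probability (X * bool)%type R)
    (H : {fset {mfun X >-> bool}}) (eta : R) (x : X) : \bar R :=
  if all (fun h : {mfun X >-> bool} => h x) (enum_fset H) then +oo%E
  else if all (fun h : {mfun X >-> bool} => ~~ h x) (enum_fset H) then -oo%E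
  else (eta^-1 *
    ln ((\sum_(h <- enum_fset H | h x) expR (- (eta * true_error D h))) /
        (\sum_(h <- enum_fset H | ~~ h x) expR (- (eta * true_error D h)))))%:E.

(* Main.v *)
Require Import Defs.
From mathcomp Require Import measurable_realfun ring lra.

Set Implicit Arguments.
Unset Strict Implicit.
Unset Printing Implicit Defensive.

(** Give each hypothesis [h] the Gibbs weight [w h = expR (- eta * err h)], and
    let [a = expR (eta * t)]. Clearing the logarithm, the event
    [y * l(x) <= t] says exactly that the weight of the hypotheses that are
    right at [(x, y)] is at most [a] times the weight of those that are wrong,
    i.e. that the total weight is at most [1 + a] times the wrong weight
    ([log_ratio_le]). In this form the event is visibly measurable.

    The expected wrong weight is [\sum_h w h * err h], so Markov's inequality
    ([weighted_markov]) would bound the probability of the event, were it not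
    for hypotheses of large error. Call [h] good if [err h <= eps + gamma], and
    split the total weight into [Wg + Wb]. The best hypothesis alone gives
    [Wg >= expR (- eta * eps)], while each bad one weighs at most
    [expR (- eta * (eps + gamma))]; hence [Wb <= |H| * expR (- eta * gamma) * Wg].
    Even if all bad hypotheses are wrong, on the event the good ones that are
    wrong weigh at least [(Wg - a * Wb) / (1 + a)]. Their expected weight is at
    most [(eps + gamma) * Wg], so with [u = a * |H| * expR (- eta * gamma)]
    Markov gives

      [Pr <= (1 + a) * (eps + gamma) / (1 - u)].

    The lower bound on [gamma] makes [|H| * expR (- eta * gamma) <= 1 / 8], and
    [eta * t <= 1] makes [a <= expR 1 <= 3], so [u <= 1 / 2] and
    [1 / (1 - u) <= 1 + 2 * u] ([small_log_ratio_bound]). Both inequalities of the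
    theorem are this bound, for [t = 0] and for [t = 2 * Delta]. *)

(** * A Markov inequality for weighted families of events *)

(** This is Markov's inequality for the random variable
    [\sum_i w i * \1_(E i)]; keeping the sum explicit turns its expectation
    into the weighted sum of the probabilities of the events. *)
Lemma weighted_markov (R : realType) (d : measure_display)
    (T : measurableType d) (P : probability T R) (I : Type) (r : seq I)
    (Q : pred I) (w : I -> R) (E : I -> set T) (A : set T) (c : R) :
  (forall i, measurable (E i)) -> measurable A ->
  (forall i, 0 <= w i) -> 0 <= c ->
  (forall z, A z -> c <= \sum_(i <- r | Q i) w i * \1_(E i) z) ->
  c * fine (P A) <= \sum_(i <- r | Q i) w i * fine (P (E i)).
Proof.
move=> mE mA w0 c0 Ac.
have finP B : measurable B -> P B = (fine (P B))%:E.
  by move=> mB; rewrite fineK// fin_num_measure.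
have mterm (k : R) B : measurable B ->
    measurable_fun [set: T] (fun z => (k * \1_B z)%:E).
  move=> mB; apply: measurableT_comp => //.
  by apply: measurable_funM; [exact: measurable_cst|exact: measurable_indic].
have intZ (k : R) B : 0 <= k -> measurable B ->
    (\int[P]_z (k * \1_B z)%:E = (k * fine (P B))%:E)%E.
  move=> k0 mB; under eq_integral do rewrite EFinM.
  rewrite ge0_integralZl//; last first.
    by apply: measurableT_comp => //; exact: measurable_indic.
  by rewrite integral_indic// setIT EFinM -finP.
rewrite -lee_fin -intZ// -sumEFin.
under eq_bigr do rewrite -intZ//.
rewrite -big_filter -ge0_integral_sum//; last 2 first.
- by move=> i; exact: mterm.
- by move=> i z _; rewrite lee_fin mulr_ge0.
apply: ge0_le_integral => //.
- by move=> z _; rewrite lee_fin mulr_ge0.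
- exact: mterm.
- by apply: emeasurable_sum => i; exact: mterm.
- move=> z _; rewrite sumEFin lee_fin big_filter.
  rewrite {1}indicE; case: (boolP (z \in A)) => [/set_mem Az|_].
    by rewrite mulr1; exact: Ac.
  by rewrite mulr0 sumr_ge0// => i _; rewrite mulr_ge0.
Qed.

(** * Estimates on exponentials and logarithms *)

Lemma scaled_ln_le (R : realType) (eta t p q : R) :
  0 < eta -> 0 < p -> 0 < q ->
  (eta^-1 * ln (p / q) <= t) = (p <= expR (eta * t) * q).
Proof.
move=> eta0 p0 q0; rewrite -[RHS]ler_pdivrMr// ler_pdivrMl//.
by rewrite -ler_expR lnK// posrE divr_gt0.
Qed.

(** From [1 - 1 / 6 <= expR (- 1 / 6)] one gets [expR (1 / 6) <= 6 / 5]; the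
    exponent 6 is the least for which this route works, as
    [(6 / 5) ^ 6 < 3 < (5 / 4) ^ 5]. *)
Lemma expR1_le3 (R : realType) : expR 1 <= 3 :> R.
Proof.
have e6 : expR 6^-1 <= 6 / 5 :> R.
  have := expR_ge1Dx (- 6^-1 : R); rewrite expRN => h.
  rewrite -[leLHS]invrK -[leRHS]invrK lef_pV2 ?posrE ?invr_gt0 ?expR_gt0//.
  by apply: le_trans h; lra.
have -> : expR 1 = expR 6^-1 ^+ 6 :> R.
  by rewrite -expRM_natl mulfV.
apply: (@le_trans _ _ ((6 / 5) ^+ 6)); last by lra.
by rewrite lerXn2r ?nnegrE ?expR_ge0.
Qed.

(** * The log ratio as a weighted vote *)

Lemma measurable_mistake (R : realType) (d : measure_display)
    (X : measurableType d) (h : {mfun X >-> bool}) :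
  measurable [set xy : X * bool | h xy.1 != xy.2].
Proof.
rewrite (_ : [set _ | _] = (h @^-1` [set true]) `*` [set false] `|`
                           (h @^-1` [set false]) `*` [set true]).
  apply: measurableU; apply: measurableX => //; rewrite -[X in measurable X]setTI;
  exact: measurable_funP.
apply/seteqP; split => -[x y] /=; last by case=> -[-> ->].
by case: (h x) y => [] [] // _; [left|right].
Qed.

Definition gibbs_weight (R : realType) (d : measure_display)
    (X : measurableType d) (D : probability (X * bool)%type R) (eta : R)
    (h : {mfun X >-> bool}) : R :=
  expR (- (eta * true_error D h)).

Definition vote (R : realType) (d : measure_display)
    (X : measurableType d) (H : {fset {mfun X >-> bool}})
    (w : {mfun X >-> bool} -> R) (x : X) (b : bool) : R :=
  \sum_(h <- enum_fset H | h x == b) w h.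

Lemma vote_eq0 (R : realType) (d : measure_display)
    (X : measurableType d) (H : {fset {mfun X >-> bool}})
    (w : {mfun X >-> bool} -> R) (x : X) (b : bool) :
  all (fun h : {mfun X >-> bool} => h x == ~~ b) (enum_fset H) ->
  vote H w x b = 0.
Proof.
move=> /allP allNb; rewrite /vote big_seq_cond big1// => h /andP[/allNb/eqP ->].
by case: b {allNb}.
Qed.

Lemma vote_gt0 (R : realType) (d : measure_display)
    (X : measurableType d) (H : {fset {mfun X >-> bool}})
    (w : {mfun X >-> bool} -> R) (x : X) (b : bool) :
  (forall h, 0 < w h) ->
  ~~ all (fun h : {mfun X >-> bool} => h x == ~~ b) (enum_fset H) ->
  0 < vote H w x b.
Proof.
move=> w_gt0; rewrite -has_predC => /hasP[h hH /= hx].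
have {}hx : h x == b by move: hx; case: (h x) b => [] [].
rewrite /vote (big_rem h)//= hx ltr_pwDl//.
by apply: sumr_ge0 => g _; exact/ltW.
Qed.

(** Multiplying by the label makes the log ratio symmetric: it compares the
    votes for and against [y], whichever label [y] is. Nonemptiness of [H]
    makes the two unanimous cases exclusive, so that the order in which they
    are tested does not matter. *)
Lemma signed_log_ratioE (R : realType) (d : measure_display)
    (X : measurableType d) (H : {fset {mfun X >-> bool}})
    (D : probability (X * bool)%type R) (eta : R) (x : X) (y : bool) :
  let v := vote H (gibbs_weight D eta) x in
  H != fset0 ->
  ((label_val R y)%:E * true_log_ratio D H eta x)%E =
  if all (fun h : {mfun X >-> bool} => h x == y) (enum_fset H) then +oo%E
  else if all (fun h : {mfun X >-> bool} => h x == ~~ y) (enum_fset H) then -oo%E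
  else (eta^-1 * ln (v y / v (~~ y)))%:E.
Proof.
move=> v /fset0Pn[h0 h0H]; rewrite /v /vote /true_log_ratio.
rewrite -/(gibbs_weight D eta).
set w := gibbs_weight D eta.
have eqT (h : {mfun X >-> bool}) : (h x == true) = h x by rewrite eqb_id.
have eqF (h : {mfun X >-> bool}) : (h x == false) = ~~ h x by rewrite eqbF_neg.
rewrite -(eq_all eqT) -(eq_all eqF) -(eq_bigl _ _ eqT) -(eq_bigl _ _ eqF).
case: y => /=; first by rewrite mul1e.
case: (boolP (all _ _)) => [allT|nallT].
  rewrite ifN; first by rewrite mulN1e.
  by apply/negP => /allP/(_ _ h0H)/eqP; rewrite (eqP (allP allT _ h0H)).
case: (boolP (all _ _)) => [_|nallF]; first by rewrite mulN1e.
have vT : 0 < vote H w x true by apply: vote_gt0 => // h; exact: expR_gt0.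
have vF : 0 < vote H w x false by apply: vote_gt0 => // h; exact: expR_gt0.
by rewrite -EFinM mulN1r -mulrN -lnV ?posrE ?divr_gt0// invf_div.
Qed.

(** An equivalence, including the unanimous cases: if all hypotheses are right
    then the wrong weight is zero and both sides fail; if all are wrong then
    both sides hold. Being exact, it also yields measurability of the event. *)
Lemma log_ratio_le (R : realType) (d : measure_display)
    (X : measurableType d) (H : {fset {mfun X >-> bool}})
    (D : probability (X * bool)%type R) (eta t : R) (x : X) (y : bool) :
  H != fset0 -> 0 < eta ->
  ((label_val R y)%:E * true_log_ratio D H eta x <= t%:E)%E =
  (\sum_(h <- enum_fset H) gibbs_weight D eta h <=
     (1 + expR (eta * t)) *
     \sum_(h <- enum_fset H | h x != y) gibbs_weight D eta h).
Proof.
move=> H0 eta0; rewrite signed_log_ratioE//.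
set w := gibbs_weight D eta.
have w_gt0 h : 0 < w h by exact: expR_gt0.
rewrite (bigID (fun h : {mfun X >-> bool} => h x == y))/= -/(vote H w x y).
have -> : \sum_(h <- enum_fset H | h x != y) w h = vote H w x (~~ y).
  by apply: eq_bigl => h; case: (h x) y => [] [].
rewrite mulrDl mul1r addrC lerD2l.
have [h0 h0H] : exists h, h \in H by exact/fset0Pn.
have [ally|nally] := boolP (all _ _).
  rewrite leye_eq/= (@vote_eq0 _ _ _ _ _ _ (~~ y)) ?negbK// mulr0.
  apply/esym/negbTE; rewrite -ltNge vote_gt0//.
  apply/negP => /allP/(_ _ h0H)/eqP.
  by rewrite (eqP (allP ally _ h0H)); case: y {ally}.
have [allNy|nallNy] := boolP (all _ _).
  rewrite leNye (@vote_eq0 _ _ _ _ _ _ y)//; apply/esym.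
  rewrite mulr_ge0 ?expR_ge0//; apply: sumr_ge0 => h _; exact/ltW.
by rewrite lee_fin scaled_ln_le// vote_gt0// negbK.
Qed.

(** * Bounding the probability of a small signed log ratio *)

(** The inequality [1 / (1 - u) <= 1 + 2 * u] with the denominator cleared. *)
Lemma one_le_1B_mul1D (R : realType) (u : R) : 0 <= u <= 1 / 2 ->
  1 <= (1 - u) * (1 + 2 * u).
Proof. by move=> /andP[u0 u1]; nra. Qed.

Lemma margin_ge0 (R : realType) (eta gamma : R) (n : nat) :
  (0 < n)%N -> 0 < eta -> ln (8 * n%:R) / eta <= gamma -> 0 <= gamma.
Proof.
rewrite -(ler1n R) => n1 eta0; apply: le_trans.
by rewrite divr_ge0 ?ln_ge0 ?(ltW eta0)//; lra.
Qed.

(** The threshold [t] is kept general so that [t = 0] and [t = 2 * Delta] are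
    both instances. *)
Lemma small_log_ratio_bound (R : realType) (d : measure_display)
    (X : measurableType d) (H : {fset {mfun X >-> bool}})
    (D : probability (X * bool)%type R) (eps eta t gamma : R) :
  H != fset0 ->
  (exists2 h, h \in H & true_error D h = eps) ->
  0 < eta -> eta * t <= 1 -> ln (8 * (#|` H|)%:R) / eta <= gamma ->
  (D [set xy | (label_val R xy.2)%:E * true_log_ratio D H eta xy.1 <= t%:E]
    <= ((1 + expR (eta * t))
        * (1 + 2 * (#|` H|)%:R * expR (eta * (t - gamma)))
        * (eps + gamma))%:E)%E.
Proof.
move=> H0 [hs hsH hs_eps] eta0 t1 gamma_ge.
set A := [set _ | _].
set a := expR (eta * t); set N : R := (#|` H|)%:R.
pose w := gibbs_weight D eta.
have w_gt0 h : 0 < w h by exact: expR_gt0.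
have a0 : 0 < a by exact: expR_gt0.
have a3 : a <= 3 by apply: le_trans (expR1_le3 R); rewrite ler_expR.
have N1 : 1 <= N by rewrite /N ler1n cardfs_gt0.
have eg8 : expR (- (eta * gamma)) * N <= 8^-1.
  have : ln (8 * N) <= eta * gamma by rewrite -ler_pdivrMl// mulrC.
  rewrite -ler_expR lnK ?posrE; last by lra.
  move=> h; rewrite expRN mulrC ler_pdivrMr ?expR_gt0//; lra.
have gamma0 : 0 <= gamma.
  by apply: margin_ge0 gamma_ge; rewrite ?cardfs_gt0.
have eps0 : 0 <= eps by rewrite -hs_eps fine_ge0.
pose E (h : {mfun X >-> bool}) := [set xy : X * bool | h xy.1 != xy.2].
have mE h : measurable (E h) by exact: measurable_mistake.
pose mistakes Q z := \sum_(h <- enum_fset H | Q h) w h * \1_(E h) z.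
have mistakesE x y :
    mistakes predT (x, y) = \sum_(h <- enum_fset H | h x != y) w h.
  rewrite /mistakes [RHS]big_mkcond; apply: eq_bigr => h _.
  rewrite indicE; case: ifP => hxy; first by rewrite mem_set ?mulr1.
  by rewrite memNset ?mulr0//=; exact/negP/negbT.
pose W := \sum_(h <- enum_fset H) w h.
have AE : A = [set z | W <= (1 + a) * mistakes predT z].
  by apply/seteqP; split => -[x y]; rewrite /A /= log_ratio_le// mistakesE.
have mA : measurable A.
  have mM : measurable_fun setT (fun z => (1 + a) * mistakes predT z).
    apply: measurable_funM; first exact: measurable_cst.
    apply: measurable_sum => h; apply: measurable_funM.
      exact: measurable_cst.
    exact: measurable_indic.
  rewrite AE -[X in measurable X]setTI.
  exact: (@measurable_fun_ler _ _ R _ _ _ (measurable_cst W) mM measurableT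
            [set true]).
pose good (h : {mfun X >-> bool}) := true_error D h <= eps + gamma.
pose Wg := \sum_(h <- enum_fset H | good h) w h.
pose Wb := \sum_(h <- enum_fset H | ~~ good h) w h.
have Wg_ge : expR (- (eta * eps)) <= Wg.
  rewrite /Wg (big_rem hs)//= /good hs_eps lerDl gamma0.
  rewrite {1}/w /gibbs_weight hs_eps lerDl.
  by apply: sumr_ge0 => h _; exact/ltW.
have Wg_gt0 : 0 < Wg by apply: lt_le_trans Wg_ge; exact: expR_gt0.
pose u := a * (N * expR (- (eta * gamma))).
have u_ge0 : 0 <= u by rewrite !mulr_ge0 ?expR_ge0 ?ler0n ?ltW.
have u_le : u <= 1 / 2.
  apply: (@le_trans _ _ (3 * 8^-1)); last by lra.
  rewrite /u ler_pM//; first exact: ltW.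
    by rewrite mulr_ge0 ?expR_ge0 ?ler0n.
  by rewrite mulrC.
have aWb_le : a * Wb <= u * Wg.
  rewrite /u -mulrA (ler_wpM2l (ltW a0))//.
  apply: (@le_trans _ _ (N * expR (- (eta * (eps + gamma))))).
    have -> : N * expR (- (eta * (eps + gamma))) =
        \sum_(h <- enum_fset H) expR (- (eta * (eps + gamma))).
      by rewrite big_const_seq count_predT iter_addr_0 mulr_natl.
    rewrite /Wb big_mkcond; apply: ler_sum => h _.
    case: ifP => [|_]; last exact: expR_ge0.
    by rewrite /good -ltNge => /ltW bad; rewrite ler_expR lerN2 ler_wpM2l// ltW.
  rewrite mulrDr opprD expRD [expR _ * expR _]mulrC mulrA.
  by rewrite ler_wpM2l// mulr_ge0 ?expR_ge0 ?ler0n.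
pose c := (Wg - a * Wb) / (1 + a).
have a1 : 0 < 1 + a by lra.
have c_ge : Wg * (1 - u) <= c * (1 + a).
  by rewrite /c divfK ?gt_eqF//; lra.
have c_ge0 : 0 <= c.
  rewrite -(pmulr_lge0 _ a1); apply: le_trans c_ge.
  by rewrite mulr_ge0// 1?ltW//; lra.
(* The wrong weight of bad hypotheses is replaced by the whole of [Wb], as if
   all of them erred at [z]. *)
have c_le z : A z -> c <= mistakes good z.
  rewrite AE /= => Az; rewrite /c ler_pdivrMr//.
  have WE : W = Wg + Wb by rewrite /W (bigID good).
  have ME : mistakes predT z = mistakes good z + mistakes (predC good) z.
    by rewrite /mistakes (bigID good).
  have Mb : mistakes (predC good) z <= Wb.
    apply: ler_sum => h _; rewrite -[leRHS]mulr1.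
    apply: ler_wpM2l; first exact: ltW.
    by rewrite indicE; case: (_ \in _).
  have := ler_wpM2l (ltW a1) Mb; rewrite WE ME in Az; lra.
have markov : c * fine (D A) <= (eps + gamma) * Wg.
  apply: (@le_trans _ _ (\sum_(h <- enum_fset H | good h) w h * fine (D (E h)))).
    by apply: weighted_markov => // h; exact/ltW.
  rewrite mulr_sumr ler_sum// => h goodh.
  by rewrite mulrC ler_wpM2r// ltW.
set p := fine (D A) in markov.
have p0 : 0 <= p by rewrite fine_ge0.
have -> : D A = p%:E by rewrite fineK// fin_num_measure.
rewrite lee_fin.
have -> : 2 * N * expR (eta * (t - gamma)) = 2 * u.
  by rewrite /u /a mulrBr expRD; ring.
have p_le : (1 - u) * p <= (1 + a) * (eps + gamma).
  rewrite -(ler_pM2l Wg_gt0).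
  have h1 := ler_wpM2r p0 c_ge.
  have h2 := ler_wpM2l (ltW a1) markov.
  lra.
have h1 : p <= (1 - u) * (1 + 2 * u) * p.
  by rewrite -[leLHS]mul1r ler_wpM2r// one_le_1B_mul1D// u_ge0.
apply: (le_trans h1).
have u2 : 0 <= 1 + 2 * u by lra.
have := ler_wpM2l u2 p_le; lra.
Qed.

Theorem theorem4 (R : realType) (d : measure_display) (X : measurableType d)
    (H : {fset {mfun X >-> bool}}) (D : probability (X * bool)%type R)
    (eps eta Delta gamma : R)
    (H_nonempty : H != fset0)
    (eps_attained : exists2 h, h \in H & true_error D h = eps)
    (eps_lower : forall h, h \in H -> eps <= true_error D h)
    (eta_gt0 : 0 < eta) (Delta_ge0 : 0 <= Delta)
    (Delta_eta : Delta * eta <= 1 / 2)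
    (gamma_ge : ln (8 * (#|` H|)%:R) / eta <= gamma) :
  (D [set xy | (label_val R xy.2)%:E * true_log_ratio D H eta xy.1 <= 0]
    <= (2 * (1 + 2 * (#|` H|)%:R * expR (- (eta * gamma))) * (eps + gamma))%:E)%E
  /\
  (D [set xy | (label_val R xy.2)%:E * true_log_ratio D H eta xy.1
                 <= (2 * Delta)%:E]
    <= ((1 + expR (2 * Delta * eta))
        * (1 + 2 * (#|` H|)%:R * expR (eta * (2 * Delta - gamma)))
        * (eps + gamma))%:E
    <= (4 * (1 + 2 * (#|` H|)%:R * expR (eta * (2 * Delta - gamma)))
        * (eps + gamma))%:E)%E.
Proof.
have bound t (t1 : eta * t <= 1) :=
  small_log_ratio_bound H_nonempty eps_attained eta_gt0 t1 gamma_ge.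
split.
  have := bound 0; rewrite mulr0 sub0r mulrN expR0.
  by apply; exact: ler01.
have eta_t : eta * (2 * Delta) <= 1 by lra.
apply/andP; split.
  by rewrite [2 * Delta * eta]mulrC; exact: bound.
have eps_ge0 : 0 <= eps.
  by case: eps_attained => h _ <-; rewrite fine_ge0.
have gamma_ge0 : 0 <= gamma.
  by apply: margin_ge0 gamma_ge; rewrite ?cardfs_gt0.
rewrite lee_fin ler_wpM2r ?addr_ge0// ler_wpM2r//.
have : expR (2 * Delta * eta) <= 3.
  by apply: le_trans (expR1_le3 R); rewrite ler_expR mulrC.
by lra.
Qed.
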